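(* For every positive integer $k$, let $A_k$ be the graph constructed as follows: take a star $K_{1,2^k}$ with center $c$, whose leaves are labeled bijectively by the binary strings of length $k$; add $k$ new vertices $u_1,\dots,u_k$, where $u_i$ is adjacent to exactly the leaves whose label has $0$ in the $i$-th digit; add all edges $u_iu_j$ for $1\le i<j\le k$; and delete the leaf labeled by the all-$1$ string. Then $\textnormal{adim}(A_k)=k$ and $\textnormal{ftadim}(A_k)\ge 2^{k-1}$.
   Context: Graphs are finite, simple, undirected. A set $S=\{v_1,\dots,v_k\}$ of vertices is an adjacency resolving set of $G$ if the vectors $(\min(2,\textnormal{dist}(u,v_1)),\dots,\min(2,\textnormal{dist}(u,v_k)))$ are pairwise distinct over $u\in V(G)$. $\textnormal{adim}(G)$ is the minimum size of an adjacency resolving set; $\textnormal{ftadim}(G)$ is the minimum size of a nonempty $S\subseteq V(G)$ such that $S-\{s\}$ is an adjacency resolving set for every $s\in S$. *)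

(* Defs.v *)
From HB Require Import structures.
From mathcomp Require Import all_boot.

Set Implicit Arguments.
Unset Strict Implicit.
Unset Printing Implicit Defensive.

Record sgraph := SGraph {
  vertex :> finType;
  adj : rel vertex;
  adj_sym : symmetric adj;
  adj_irrefl : irreflexive adj }.

Section Distance.
Variable G : sgraph.
Implicit Types (u v s : G) (S : {set G}) (n : nat).

Definition walk n u v :=
  [exists p : n.-tuple G, path (@adj G) u p && (last u p == v)].

(* Length of a shortest walk, with None standing for infinity. Searching      *)
(* lengths below #|G| suffices because shortest walks do not repeat vertices. *)
Definition dist u v : option nat :=
  let n := find (fun m => walk m u v) (iota 0 #|G|) in
  if n < #|G| then Some n else None.

Definition dist2 u v : nat := if dist u v is Some n then minn 2 n else 2.

Definition adj_vector S u : seq nat := [seq dist2 u v | v <- enum S].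

Definition adj_resolving S : bool := injectiveb (adj_vector S).

Definition ft_adj_resolving S : bool :=
  (S != set0) && [forall s in S, adj_resolving (S :\ s)].

(* [set: G] only serves as a default value: it is an adjacency resolving set, *)
(* and a fault-tolerant one when G has a vertex (see the lemmas below).       *)
Definition adim : nat := #|[arg min_(S < [set: G] | adj_resolving S) #|S| ]|.

Definition ftadim : nat :=
  #|[arg min_(S < [set: G] | ft_adj_resolving S) #|S| ]|.

Lemma walkP n u v :
  reflect (exists p : seq G, [/\ size p = n, path (@adj G) u p & last u p = v])
          (walk n u v).
Proof.
apply: (iffP existsP) => [[p /andP[up /eqP pv]]|[p [sp up pv]]].
  by exists p; rewrite size_tuple.
by move/eqP: sp => sp; exists (Tuple sp); rewrite up pv /=.
Qed.

Lemma walk_lt_card n u v :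
  walk n u v -> exists2 m, m <= n & (m < #|G|) && walk m u v.
Proof.
case/walkP=> p [<- up <-]; case: (shortenP up) => p' up' Up' p'p.
exists (size p'); first by apply: uniq_leq_size => //; case/andP: Up'.
apply/andP; split; last by apply/walkP; exists p'.
by rewrite -[(size p').+1]/(size (u :: p')) -(card_uniqP Up') max_card.
Qed.

Lemma dist_Some u v n :
  dist u v = Some n <-> walk n u v /\ forall m, walk m u v -> n <= m.
Proof.
rewrite /dist; set a := fun m => walk m u v.
set f := find a _; have sz := size_iota 0 #|G|.
have fmin m : m < f -> m < #|G| -> ~~ a m.
  by move=> mf mG; have := before_find 0 mf; rewrite nth_iota // => ->.
have fwalk : f < #|G| -> a f.
  move=> fG; have := @nth_find _ 0 a (iota 0 #|G|).
  by rewrite has_find sz -/f nth_iota // => ->.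
split.
  case: ifP => // fG [<-]; split=> [|m um]; first exact: fwalk.
  rewrite leqNgt; apply/negP => mf.
  by have := fmin m mf (ltn_trans mf fG); rewrite /a um.
case=> un nmin; have [m mn /andP[mG um]] := walk_lt_card un.
have nG : n < #|G| := leq_ltn_trans (nmin m um) mG.
have fn : f <= n by rewrite leqNgt; apply/negP => nf; have := fmin n nf nG; rewrite /a un.
have fG := leq_ltn_trans fn nG; rewrite fG; congr Some.
by apply/eqP; rewrite eqn_leq fn nmin //; apply: fwalk.
Qed.

Lemma dist_None u v : dist u v = None <-> forall n, ~~ walk n u v.
Proof.
split=> [dN n|N].
  apply/negP => un; have ex : exists n, walk n u v by exists n.
  case: (ex_minnP ex) => m um mmin.
  by have := (dist_Some u v m).2 (conj um mmin); rewrite dN.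
case duv: (dist u v) => [n|] //.
by case: ((dist_Some u v n).1 duv) => un; have := N n; rewrite un.
Qed.

Lemma dist2_eq0 u v : (dist2 u v == 0) = (u == v).
Proof.
rewrite /dist2; case duv: (dist u v) => [n|].
  have [un nmin] := (dist_Some u v n).1 duv.
  have -> : (minn 2 n == 0) = (n == 0) by rewrite /minn; case: ltnP => //; case: (n).
  apply/eqP/eqP => [n0|uv].
    by move: un; rewrite n0 => /walkP[[|w p] []].
  by apply/eqP; rewrite -leqn0 nmin //; apply/walkP; exists [::].
apply/esym/negbTE/eqP => uv; have := (dist_None u v).1 duv 0.
by move/negP; apply; apply/walkP; exists [::].
Qed.

Lemma adj_resolving_setT1 s : adj_resolving [set~ s].
Proof.
apply/injectiveP => u v /eq_in_map uv.
have key w : w != s -> dist2 u w = dist2 v w.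
  by move=> ws; apply: uv; rewrite mem_enum !inE.
case: (eqVneq u s) => [us|us]; last first.
  by apply/esym/eqP; rewrite -dist2_eq0 -key // dist2_eq0.
case: (eqVneq v s) => [->//|vs].
by apply/eqP; rewrite -dist2_eq0 key // dist2_eq0.
Qed.

Lemma adj_resolving_setT : adj_resolving [set: G].
Proof.
apply/injectiveP => u v /eq_in_map uv.
by apply/eqP; rewrite -dist2_eq0 uv ?mem_enum ?inE //= dist2_eq0.
Qed.

Lemma ft_adj_resolving_setT : 0 < #|G| -> ft_adj_resolving [set: G].
Proof.
move=> G0; rewrite /ft_adj_resolving -card_gt0 cardsT G0 /=.
by apply/forall_inP => s _; rewrite setTD; apply: adj_resolving_setT1.
Qed.

Lemma adimP n :
  adim = n <-> (exists2 S, adj_resolving S & #|S| = n) /\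
               (forall S, adj_resolving S -> n <= #|S|).
Proof.
rewrite /adim; case: arg_minnP => [|S RS Smin]; first exact: adj_resolving_setT.
split=> [<-|[[S' RS' <-] min]]; first by split=> //; exists S.
by apply/eqP; rewrite eqn_leq Smin ?min.
Qed.

Lemma ftadimP n : 0 < #|G| ->
  ftadim = n <-> (exists2 S, ft_adj_resolving S & #|S| = n) /\
                 (forall S, ft_adj_resolving S -> n <= #|S|).
Proof.
move=> G0; rewrite /ftadim.
case: arg_minnP => [|S RS Smin]; first exact: ft_adj_resolving_setT.
split=> [<-|[[S' RS' <-] min]]; first by split=> //; exists S.
by apply/eqP; rewrite eqn_leq Smin ?min.
Qed.

End Distance.

Section DeleteVertex.
Variables (G : sgraph) (x : G).

Definition del_adj : rel {y : G | y != x} := fun y z => adj (val y) (val z).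

Lemma del_adj_sym : symmetric del_adj.
Proof. by move=> y z; apply: adj_sym. Qed.

Lemma del_adj_irrefl : irreflexive del_adj.
Proof. by move=> y; apply: adj_irrefl. Qed.

Definition del_vertex : sgraph := SGraph del_adj_sym del_adj_irrefl.

End DeleteVertex.

Section GraphA.
Variable k : nat.

(* The graph before deletion: the center c, the leaves, which are the binary  *)
(* strings of length k (false for the digit 0, true for 1), and u_1 ... u_k.  *)
Definition full_vertex : Type := unit + k.-tuple bool + 'I_k.

Definition center : full_vertex := inl (inl tt).
Definition leaf (b : k.-tuple bool) : full_vertex := inl (inr b).
Definition uvertex (i : 'I_k) : full_vertex := inr i.

Definition full_adj (x y : full_vertex) : bool :=
  match x, y with
  | inl (inl _), inl (inr _) | inl (inr _), inl (inl _) => true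
  | inr i, inl (inr b) | inl (inr b), inr i => tnth b i == false
  | inr i, inr j => i != j
  | _, _ => false
  end.

Lemma full_adj_sym : symmetric full_adj.
Proof. by case=> [[[]|b]|i] [[[]|b']|j] //=; rewrite eq_sym. Qed.

Lemma full_adj_irrefl : irreflexive full_adj.
Proof. by case=> [[[]|b]|i] //=; rewrite eqxx. Qed.

Definition full_graph : sgraph := SGraph full_adj_sym full_adj_irrefl.

Definition graphA : sgraph := @del_vertex full_graph (leaf [tuple of nseq k true]).

End GraphA.

(* Main.v *)
Require Import Defs.
From mathcomp Require Import all_boot.

Set Implicit Arguments.
Unset Strict Implicit.
Unset Printing Implicit Defensive.

(** The clique [u_1 ... u_k] is adjacency resolving because a leaf reads its
    label off its adjacencies to the [u_i]; the center reads the deleted all-1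
    label. Conversely, the vertices outside a resolving set [S] have distinct
    neighborhoods in [S], so that [#|G| <= #|S| + 2 ^ #|S|].
    For the fault-tolerant bound, two leaves [0t] and [1t] differing only in the
    first digit are resolved by [0t], [1t] and [u_1] only, and two of these must
    lie in [S]. So [S] has a leaf in each of the [2 ^ (k - 1) - 1] pairs, and
    one more element: [u_1], or the second leaf of a pair if [u_1 \notin S]. *)

Section AdjacencyResolving.
Variable G : sgraph.
Implicit Types (u v s : G) (S : {set G}).

(** Walks of length 0 and 1 decide the truncated distance, so later arguments need only equality and
    adjacency. *)
Lemma dist2E u v :
  dist2 u v = if u == v then 0 else if adj u v then 1 else 2.
Proof.
case: eqVneq => [->|uv]; first by apply/eqP; rewrite dist2_eq0.
have walk1 : walk 1 u v = adj u v.
  apply/walkP/idP => [[[|w [|x p]] [] //= _]|auv]; first by rewrite andbT => + <-.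
  by exists [:: v]; rewrite /= auv.
have walk0 : walk 0 u v = false.
  apply/negbTE/negP => /walkP[[|w p] [] //= _ _ uv'].
  by rewrite uv' eqxx in uv.
case: ifP => auv; rewrite /dist2.
  suff /dist_Some -> : walk 1 u v /\ forall m, walk m u v -> 1 <= m by [].
  by rewrite walk1; split=> // -[|//]; rewrite walk0.
case duv: (dist u v) => [[|[|n]]|] //; have [] := (dist_Some u v _).1 duv.
- by rewrite walk0.
- by rewrite walk1 auv.
- by case: n {duv}.
Qed.

Lemma adj_resolvingP S :
  reflect (forall u v, {in S, dist2 u =1 dist2 v} -> u = v) (adj_resolving S).
Proof.
apply: (iffP (injectiveP (adj_vector S))) => inj u v uv; apply: inj.
  by apply/eq_in_map => s; rewrite mem_enum; apply: uv.
by move=> s sS; move/eq_in_map: uv; apply; rewrite mem_enum.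
Qed.

Lemma adj_resolvingS S S' :
  S \subset S' -> adj_resolving S -> adj_resolving S'.
Proof.
move=> /subsetP SS' /adj_resolvingP RS; apply/adj_resolvingP => u v uv.
by apply: RS => s /SS'; apply: uv.
Qed.

Lemma leq_card_adj_resolving S : adj_resolving S -> #|G| <= #|S| + 2 ^ #|S|.
Proof.
move=> /adj_resolvingP RS; rewrite -(cardsC S) leq_add2l -card_powerset.
pose N u := [set s in S | adj u s].
have injN : {in ~: S &, injective N}.
  move=> u v; rewrite !inE => uS vS /setP Nuv; apply: RS => s sS.
  have neq w : w \notin S -> (w == s) = false.
    by move=> wS; apply: contraNF wS => /eqP->.
  (* Neither vertex lies in [S], so the value 0 is excluded and adjacency to [s] determines the
     coordinate. *)
  by have := Nuv s; rewrite !inE sS !dist2E !neq //= => ->.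
rewrite -(card_in_imset injN) subset_leq_card //.
apply/subsetP => _ /imsetP[u _ ->]; rewrite inE.
by apply/subsetP => s; rewrite inE => /andP[].
Qed.

Lemma ft_adj_resolving_witness S u v s :
    ft_adj_resolving S -> u != v ->
  exists r, [/\ r \in S, r != s & dist2 u r != dist2 v r].
Proof.
case/andP=> S0 /forall_inP RS uv.
have RSs : adj_resolving (S :\ s).
  have [/RS //|sS] := boolP (s \in S).
  (* If [s] is not in [S], some [x] of [S] is removed instead, and [S :\ x] is contained in
     [S :\ s]. *)
  have [x xS] := set0Pn _ S0; apply: adj_resolvingS (RS x xS).
  by rewrite subsetD1 subsetDl !inE (negbTE sS) andbF.
have /existsP[r /and3P[? ? ?]] :
    [exists r, [&& r \in S, r != s & dist2 u r != dist2 v r]].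
  apply: contraNT uv => /existsPn H; apply/eqP.
  move/adj_resolvingP: RSs; apply=> r /setD1P[rs rS].
  by apply/eqP; have := H r; rewrite rS rs negbK.
by exists r.
Qed.

End AdjacencyResolving.

Section GraphA.
Variable k : nat.

Definition centerA : graphA k := exist _ (center k) isT.
Definition uvertexA (i : 'I_k) : graphA k := exist _ (uvertex i) isT.
(* The junk value on the deleted all-1 string is [centerA]. *)
Definition leafA (b : k.-tuple bool) : graphA k := insubd centerA (leaf b).

Lemma val_leafA b : b != [tuple of nseq k true] -> val (leafA b) = leaf b.
Proof. by move=> b1; apply: insubdK. Qed.

Lemma uvertexA_inj : injective uvertexA.
Proof. by move=> i j /(congr1 val)[]. Qed.

Lemma card_graphA : #|graphA k| = 2 ^ k + k.
Proof.
rewrite card_sig (cardC1 (leaf [tuple of nseq k true] : full_graph k)).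
by rewrite !card_sum card_unit card_tuple card_bool card_ord.
Qed.

Variant graphA_spec : graphA k -> Prop :=
| CenterA : graphA_spec centerA
| LeafA b of b != [tuple of nseq k true] : graphA_spec (leafA b)
| UvertexA i : graphA_spec (uvertexA i).

Lemma graphAP x : graphA_spec x.
Proof.
case vx: (val x) => [[[]|b]|i].
- have -> : x = centerA by apply: val_inj.
  by constructor.
- have b1 : b != [tuple of nseq k true].
    by apply: contraNneq (valP x) => b1; rewrite vx b1.
  have -> : x = leafA b by apply: val_inj; rewrite val_leafA.
  by constructor.
- have -> : x = uvertexA i by apply: val_inj.
  by constructor.
Qed.

Lemma dist2_centerA_uvertexA i : dist2 centerA (uvertexA i) = 2.
Proof. by rewrite dist2E. Qed.

(** Digit 0 means adjacent, at distance 1; digit 1 means truncated distance 2. *)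
Lemma dist2_leafA_uvertexA b i : b != [tuple of nseq k true] ->
  dist2 (leafA b) (uvertexA i) = (tnth b i).+1.
Proof.
move=> b1; rewrite dist2E -val_eqE /= /del_adj val_leafA //=.
by case: (tnth b i).
Qed.

Lemma adj_resolving_uvertexA : adj_resolving (uvertexA @: 'I_k).
Proof.
apply/adj_resolvingP => x y xy.
have {}xy i : dist2 x (uvertexA i) = dist2 y (uvertexA i).
  by apply: xy; apply: imset_f.
(* The center has all coordinates 2, so a leaf sharing its vector would carry the deleted label. *)
have eq_ones (b : k.-tuple bool) :
    (forall i, 2 = (tnth b i).+1) -> b = [tuple of nseq k true].
  move=> b1; apply: eq_from_tnth => i; rewrite tnth_nseq.
  by have := b1 i; case: (tnth b i).
case: (graphAP y) xy => [|b b1|i] xy; last first.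
(* A clique vertex is recognized by its coordinate 0 at itself. *)
- by apply/eqP; rewrite -dist2_eq0 xy dist2_eq0.
- case: (graphAP x) xy => [|b' b1'|i] xy; last first.
  + by apply/esym/eqP; rewrite -dist2_eq0 -xy dist2_eq0.
  + congr leafA; apply: eq_from_tnth => i; have := xy i.
    by rewrite !dist2_leafA_uvertexA //; case: (tnth b i) (tnth b' i) => [] [].
  + case: (elimN eqP b1); apply: eq_ones => i.
    by have := xy i; rewrite dist2_centerA_uvertexA dist2_leafA_uvertexA.
- case: (graphAP x) xy => [//|b b1|i] xy; last first.
  + by apply/esym/eqP; rewrite -dist2_eq0 -xy dist2_eq0.
  + case: (elimN eqP b1); apply: eq_ones => i.
    by have := xy i; rewrite dist2_centerA_uvertexA dist2_leafA_uvertexA.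
Qed.

Lemma adim_graphA : adim (graphA k) = k.
Proof.
apply/adimP; split.
  exists (uvertexA @: 'I_k); first exact: adj_resolving_uvertexA.
  by rewrite card_imset ?card_ord //; apply: uvertexA_inj.
move=> S /leq_card_adj_resolving; rewrite card_graphA.
apply: contraTT; rewrite -!ltnNge => Sk.
by rewrite addnC -addnS leq_add // leq_exp2l // ltnW.
Qed.

End GraphA.

Section FaultTolerance.
Variable n : nat.
Implicit Types (t : n.-tuple bool) (a : bool).

Let ones := [tuple of nseq n true].
Let u1 : graphA n.+1 := uvertexA ord0.
(** For [t] equal to [ones], [L true t] is deleted and defaults to the center, so pairs are indexed
    by the other [t]. *)
Let L a t : graphA n.+1 := leafA [tuple of a :: t].

Lemma val_leafA_cons a t : t != ones -> val (L a t) = leaf [tuple of a :: t].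
Proof.
move=> t1; apply: val_leafA; apply: contraNneq t1 => /(congr1 val)[_ tE].
by apply/eqP/val_inj.
Qed.

Lemma leafA_cons_inj a a' t t' :
  t != ones -> t' != ones -> L a t = L a' t' -> a = a' /\ t = t'.
Proof.
move=> t1 t1' /(congr1 val); rewrite !val_leafA_cons // => -[-> tE].
by split=> //; apply: val_inj.
Qed.

(** The center is adjacent to both leaves, any other leaf to neither, and a later [u_i] reads only a
    digit of [t]. *)
Lemma leafA_cons_resolver t r : t != ones ->
  dist2 (L false t) r != dist2 (L true t) r -> r \in [:: L false t; L true t; u1].
Proof.
move=> t1; apply: contraR; rewrite !inE !negb_or => /and3P[r0 r1 ru].
rewrite !dist2E !(eq_sym _ r) (negbTE r0) (negbTE r1) /= /del_adj.
rewrite !val_leafA_cons //; case: (graphAP r) ru => //= [b b1|i] ru.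
  by rewrite val_leafA.
have [j ->] : exists j, i = lift ord0 j.
  case: (unliftP ord0 i) => [j ->|i0]; first by exists j.
  by rewrite i0 eqxx in ru.
by rewrite !tnthS.
Qed.

Lemma ft_adj_resolving_graphA_card (S : {set graphA n.+1}) :
  ft_adj_resolving S -> 2 ^ n <= #|S|.
Proof.
move=> ftS.
have resolver t s : t != ones ->
    exists r, [/\ r \in S, r != s & r \in [:: L false t; L true t; u1]].
  move=> t1; have Lt : L false t != L true t.
    by apply/eqP => /leafA_cons_inj [].
  have [r [rS rs]] := ft_adj_resolving_witness s ftS Lt.
  by move=> /(leafA_cons_resolver t1) ?; exists r.
(* The first digit is chosen so that [f t] is [L false t] when that lies in [S], and [L true t]
   otherwise. *)
pose f t := L (L false t \notin S) t.
have fS t : t != ones -> f t \in S.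
  move=> t1; rewrite /f; case: (boolP (L false t \in S)) => //= t0S.
  have [r [rS ru]] := resolver t u1 t1; rewrite !inE (negbTE ru) orbF.
  by case/orP=> /eqP rE; rewrite rE // in rS t0S; rewrite rS in t0S.
have injf : {in [set~ ones] &, injective f}.
  by move=> t t'; rewrite !inE => t1 t1' /leafA_cons_inj [].
have [e eS ef] : exists2 e, e \in S & e \notin f @: [set~ ones].
  have [uS|uS] := boolP (u1 \in S).
    exists u1 => //; apply/imsetP => -[t]; rewrite !inE => t1 /(congr1 val).
    by rewrite val_leafA_cons.
  (* There are no pairs when [n = 0]; then any element of the nonempty [S] serves. *)
  have [P0|[t]] := set_0Vmem [set~ ones].
    have [x xS] := set0Pn _ (andP ftS).1.
    by exists x; rewrite // P0 imset0 inE.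
  (* Without [u1], excluding one leaf of a pair leaves the other as the only possible resolver. *)
  have bothS a t' : t' != ones -> L a t' \in S.
    move=> t1; have [r [rS rs]] := resolver t' (L (~~ a) t') t1.
    have ru : (r == u1) = false by apply: contraNF uS => /eqP <-.
    by case: a rs => /= /negbTE rs; rewrite !inE ru rs ?orbF /= => /eqP <-.
  (* With both leaves of every pair in [S], [f] always picks the one starting with 0, so [L true t]
     is missed. *)
  rewrite !inE => t1; exists (L true t); first exact: bothS.
  apply/imsetP => -[t']; rewrite !inE => t1' /leafA_cons_inj [] //.
  by rewrite bothS.
rewrite (cardsD1 e) eS add1n.
have -> : 2 ^ n = #|f @: [set~ ones]|.+1.
  rewrite (card_in_imset injf) cardsC1 card_tuple card_bool prednK //.
  by rewrite expn_gt0.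
rewrite ltnS subset_leq_card // subsetD1 ef andbT.
by apply/subsetP => _ /imsetP[t + ->]; rewrite !inE; apply: fS.
Qed.

End FaultTolerance.

Theorem theorem18 (k : nat) (hk : 0 < k) :
  adim (graphA k) = k /\ 2 ^ (k - 1) <= ftadim (graphA k).
Proof.
split; first exact: adim_graphA.
case: k hk => // n _; rewrite subn1 /=.
have G0 : 0 < #|graphA n.+1| by rewrite card_graphA addnS.
have [[S ftS <-] _] := (ftadimP (ftadim (graphA n.+1)) G0).1 erefl.
exact: ft_adj_resolving_graphA_card.
Qed.
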